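(* Let $k=\mathbb{F}_q$ be a finite field. For any quasiprojective variety $V$ defined over $k$, the following identities of formal power series hold: $$f_V(x)=Z(V/k,x)/Z(V/k,x^2),\qquad \overline{f}_V(x)=Z(V/k,x).$$
   Context: Let $\bar k$ be an algebraic closure of $k=\mathbb{F}_q$ and $k_r=\mathbb{F}_{q^r}\subset \bar k$. A $k$-rational $n$-set (resp. $n$-multiset) of $V$ is an $n$-element subset (resp. multiset of cardinality $n$) of $V(\bar k)$ that is stable under $\mathrm{Gal}(\bar k/k)$. Let $a_V(n)$ (resp. $\overline a_V(n)$) be the number of $k$-rational $n$-sets (resp. $n$-multisets) of $V$, with $a_V(0)=\overline a_V(0)=1$. Put $f_V(x)=\sum_{n\ge0}a_V(n)x^n$ and $\overline f_V(x)=\sum_{n\ge0}\overline a_V(n)x^n$. The zeta function is $Z(V/k,x)=\exp\left(\sum_{r\ge1}\frac1r|V(k_r)|x^r\right)$. *)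

(* Defs.v *)
From HB Require Import structures.
From mathcomp Require Import all_boot all_order all_algebra.
From mathcomp Require Import finmap multiset.
From mathcomp Require Import mpoly.
From mathcomp Require Import boolp classical_sets cardinality.

Set Implicit Arguments.
Unset Strict Implicit.
Unset Printing Implicit Defensive.

Import GRing.Theory.
Local Open Scope mset_scope.
Local Open Scope ring_scope.

Definition fps (R : Type) := nat -> R.

Section Fps.
Variable F : fieldType.
Implicit Types f g : fps F.

Definition fps_one : fps F := fun n => (n == 0%N)%:R.
Definition fps_mul f g : fps F := fun n => \sum_(i < n.+1) f i * g (n - i)%N.
Definition fps_pow f (k : nat) : fps F := iter k (fps_mul f) fps_one.

(* [\sum_k f ^ k / k!]; meaningful only when [f 0 = 0], and then the terms
   with [k > n] do not contribute to the coefficient of [x ^ n]. *)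
Definition fps_exp f : fps F :=
  fun n => \sum_(k < n.+1) fps_pow f k n / k`!%:R.

(* Writing [g = g 0 * (1 - u)], this is [(g 0)^-1 * \sum_k u ^ k]; it is the
   inverse of [g] as soon as [g 0 != 0], see [fps_mulV]. *)
Definition fps_inv g : fps F :=
  let u : fps F := fun m => fps_one m - (g 0%N)^-1 * g m in
  fun n => (g 0%N)^-1 * \sum_(k < n.+1) fps_pow u k n.

Definition fps_div f g : fps F := fps_mul f (fps_inv g).

(* [f (x ^ d)], for [0 < d] *)
Definition fps_subXn (d : nat) f : fps F :=
  fun n => if (d %| n)%N then f (n %/ d)%N else 0.

Lemma fps_pow_small u k n : u 0%N = 0 -> (n < k)%N -> fps_pow u k n = 0.
Proof.
move=> u0; elim: k n => // k IHk n; rewrite ltnS => le_nk.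
rewrite /fps_pow iterS /fps_mul big1 // => i _.
have [i0|i_gt0] := posnP i; first by rewrite i0 u0 mul0r.
rewrite -/(fps_pow u k) IHk ?mulr0 //.
by rewrite (leq_trans _ le_nk) // ltn_subrL i_gt0 (leq_trans i_gt0) // -ltnS.
Qed.

Lemma fps_mulV g : g 0%N != 0 -> fps_mul g (fps_inv g) =1 fps_one.
Proof.
move=> g0 n; pose u : fps F := fun m => fps_one m - (g 0%N)^-1 * g m.
rewrite /fps_inv -/u.
have u0 : u 0%N = 0 by rewrite /u /fps_one /= mulVf ?subrr.
have gE m : g m * (g 0%N)^-1 = fps_one m - u m by rewrite /u subKr mulrC.
have step i : (i < n.+1)%N ->
    g i * ((g 0%N)^-1 * \sum_(k < (n - i).+1) fps_pow u k (n - i)%N) =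
    \sum_(k < n.+1) (fps_one i - u i) * fps_pow u k (n - i)%N.
  move=> lt_in; rewrite mulrA gE big_distrr /=.
  have le_in : ((n - i).+1 <= n.+1)%N by rewrite ltnS leq_subr.
  rewrite (big_ord_widen _ (fun k => (fps_one i - u i) * fps_pow u k (n - i)%N)
             le_in) big_mkcond /=.
  apply: eq_bigr => k _; case: ltnP => // lt_k.
  by rewrite fps_pow_small ?mulr0.
rewrite /fps_mul; under eq_bigr => i _ do rewrite step //.
rewrite exchange_big /=.
have pow_step k : \sum_(i < n.+1) (fps_one i - u i) * fps_pow u k (n - i)%N =
    fps_pow u k n - fps_pow u k.+1 n.
  under eq_bigr => i _ do rewrite mulrBl.
  rewrite sumrB; congr (_ - _).
  rewrite big_ord_recl /= {1}/fps_one /= mul1r subn0 big1 ?addr0 // => i _.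
  by rewrite /fps_one /= mul0r.
under eq_bigr => k _ do rewrite pow_step -opprB.
rewrite sumrN -(big_mkord xpredT (fun k => fps_pow u k.+1 n - fps_pow u k n)).
by rewrite telescope_sumr // (@fps_pow_small u n.+1) // sub0r opprK.
Qed.

End Fps.

(* The locally closed subset [{eqs = 0} \ {neqs = 0}] of projective
   [qp_dim]-space, given by homogeneous equations over [k]; by Noetherianity
   finitely many equations suffice. *)
Record quasiproj (k : fieldType) := Quasiproj {
  qp_dim : nat;
  qp_eqs : seq {mpoly k[qp_dim.+1]};
  qp_neqs : seq {mpoly k[qp_dim.+1]};
  qp_eqs_homog : forall P, P \in qp_eqs -> exists d, P \is d.-homog;
  qp_neqs_homog : forall P, P \in qp_neqs -> exists d, P \is d.-homog }.

Definition is_algebraic_closure (k : fieldType) (K : closedFieldType)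
    (iota : {rmorphism k -> K}) : Prop :=
  forall x : K, algebraicOver iota x.

Section Points.
Variables (k : finFieldType) (K : closedFieldType) (iota : {rmorphism k -> K}).

(* The elements of the subfield of [K] with [#|k| ^ r] elements *)
Definition in_kr (r : nat) (x : K) : Prop :=
  exists S : {fset K},
    [/\ #|` S|%fset = (#|k| ^ r)%N, divring_closed (mem S) & x \in S].

Definition in_Gal (s : {rmorphism K -> K}) : Prop :=
  bijective s /\ forall a, s (iota a) = iota a.

(* Points of projective n-space are lines of ['rV[K]_n.+1]; the point with
   homogeneous coordinates [v != 0] is [<[v]>%VS]. *)
Definition gal_line n (s : {rmorphism K -> K}) (p : {vspace 'rV[K]_n.+1}) :
    {vspace 'rV[K]_n.+1} :=
  <[map_mx s (vpick p)]>%VS.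

Lemma gal_lineE n s (v : 'rV[K]_n.+1) :
  gal_line s <[v]>%VS = <[map_mx s v]>%VS.
Proof.
have [->|v0] := eqVneq v 0.
  have -> : <[0 : 'rV[K]_n.+1]>%VS = 0%VS by apply/eqP; rewrite -dimv_eq0 dim_vline eqxx.
  have /eqP e : vpick (0%VS : {vspace 'rV[K]_n.+1}) == 0 by rewrite vpick0.
  by rewrite /gal_line e map_mx0.
rewrite /gal_line; have /vlineP[c cE] := memv_pick <[v]>%VS.
have c0 : c != 0.
  have: vpick <[v]>%VS != 0 by rewrite vpick0 -dimv_eq0 dim_vline v0.
  by apply: contraNneq => c0; rewrite cE c0 scale0r.
rewrite cE map_mxZ; apply/eqP; rewrite eqEsubv -!memvE memvZ ?memv_line //=.
apply/vlineP; exists (s c)^-1.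
by rewrite scalerA mulVf ?scale1r // fmorph_eq0.
Qed.

Variable V : quasiproj k.

Definition point : choiceType := {vspace 'rV[K]_(qp_dim V).+1}.

Definition qp_eval (P : {mpoly k[(qp_dim V).+1]}) (v : 'rV[K]_(qp_dim V).+1) : K :=
  (map_mpoly iota P).@[fun i => v 0 i].

Definition qp_sat (v : 'rV[K]_(qp_dim V).+1) : Prop :=
  [/\ v != 0,
      forall P, P \in qp_eqs V -> qp_eval P v = 0 &
      exists2 Q, Q \in qp_neqs V & qp_eval Q v != 0].

Definition geom_points : set point :=
  [set p | exists2 v, qp_sat v & p = <[v]>%VS]%classic.

Lemma qp_evalZ P d c v : P \is d.-homog ->
  qp_eval P (c *: v) = c ^+ d * qp_eval P v.
Proof.
move=> /dhomogP homP; rewrite /qp_eval !mevalE big_distrr /=.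
apply: eq_big_seq => m m_supp.
have mE : mdeg m = d.
  apply: homP; move: m_supp; rewrite !mcoeff_msupp mcoeff_map_mpoly.
  by apply: contraNneq => /= ->; apply/eqP; exact: (raddf0 iota).
rewrite mulrCA; congr (_ * _); rewrite -mE mdegE -prodrXr -big_split /=.
by apply: eq_bigr => i _; rewrite mxE exprMn.
Qed.

Lemma qp_satZ c v : c != 0 -> qp_sat v -> qp_sat (c *: v).
Proof.
move=> c0 [v0 eqv [Q Qin Qv]]; split.
- by rewrite scaler_eq0 negb_or c0.
- move=> P Pin; have [d homP] := qp_eqs_homog Pin.
  by rewrite (qp_evalZ _ _ homP) eqv ?mulr0.
- have [d homQ] := qp_neqs_homog Qin.
  by exists Q => //; rewrite (qp_evalZ _ _ homQ) mulf_neq0 ?expf_neq0.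
Qed.

Lemma geom_pointsE v : v != 0 -> geom_points <[v]>%VS <-> qp_sat v.
Proof.
move=> v0; split=> [[w satw vw]|]; last by exists v.
have /vlineP[c cE] : v \in <[w]>%VS by rewrite -vw memv_line.
rewrite cE; apply: qp_satZ => //.
by apply: contraNneq v0 => c0; rewrite cE c0 scale0r.
Qed.

Definition rat_points (r : nat) : set point :=
  [set p | exists2 v, qp_sat v /\ (forall i, in_kr r (v 0 i))
         & p = <[v]>%VS]%classic.

Definition rational_nsets (n : nat) : set {fset point} :=
  [set A : {fset point} |
    [/\ #|` A|%fset = n,
        forall p, p \in A -> geom_points p &
        forall s, in_Gal s -> [fset gal_line s p | p in A]%fset = A]]%classic.

Definition rational_nmultisets (n : nat) : set {mset point} :=
  [set A : {mset point} |
    [/\ size A = n,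
        forall p, p \in A -> geom_points p &
        forall s, in_Gal s ->
          seq_mset [seq gal_line s p | p <- A] = A]]%classic.

(* All sets counted below are finite; [fset_set] turns a finite [set] into the
   corresponding [{fset _}]. *)
Definition a_V (n : nat) : nat := #|` fset_set (rational_nsets n)|%fset.
Definition abar_V (n : nat) : nat := #|` fset_set (rational_nmultisets n)|%fset.

Definition f_V : fps rat := fun n => (a_V n)%:R.
Definition fbar_V : fps rat := fun n => (abar_V n)%:R.

Definition zeta : fps rat :=
  fps_exp (fun r => if r == 0%N then 0
                    else #|` fset_set (rat_points r)|%fset%:R / r%:R).

End Points.

(* Main.v *)
(* Let [F] be the [q]-Frobenius acting on the geometric points [X] of [V].  Every
   point of [X] has a finite [F]-orbit, the points rational over F_{q^r} are
   those fixed by [F ^ r], and each element of the Galois group moves a given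
   point by some power of [F]; so rational (multi)sets are the [F]-stable ones.
   With [N r] fixed points of [F ^ r] and [b n] stable [n]-multisets,
   [n * b n = \sum_(1 <= r <= n) N r * b (n - r)]: removing the orbit of [p],
   of length [d], from the multisets containing [p] shows by induction that both
   sides count pairs (multiset, element with multiplicity).  This recurrence
   characterises the coefficients of [exp (\sum_r N r / r x ^ r)].  Finally
   a multiset is uniquely [A + 2 M], where [A] is the set of elements of odd
   multiplicity, whence [fbar x = f x * fbar (x ^ 2)]. *)
Require Import Defs.
From HB Require Import structures.
From mathcomp Require Import all_boot all_order all_algebra.
From mathcomp Require Import all_solvable all_field.
From mathcomp Require Import mpoly.
From mathcomp Require Import finmap multiset boolp classical_sets cardinality.

Set Implicit Arguments.
Unset Strict Implicit.
Unset Printing Implicit Defensive.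

Import GRing.Theory Num.Theory.
Local Open Scope ring_scope.

(** * Formal power series *)

Section FpsTheory.
Variable F : fieldType.
Implicit Types f g h : fps F.

(** Coefficients of a product up to index [n] depend only on the truncations at [n], so the ring
    laws of [fps_mul] are inherited from [{poly F}]. *)
Definition fps_trunc n f : {poly F} := \poly_(i < n.+1) f i.

Lemma fps_trunc_coef n f i : (i <= n)%N -> (fps_trunc n f)`_i = f i.
Proof. by move=> le_in; rewrite coef_poly ltnS le_in. Qed.

Lemma fps_mul_trunc n f g m : (m <= n)%N ->
  fps_mul f g m = (fps_trunc n f * fps_trunc n g)`_m.
Proof.
move=> le_mn; rewrite coefM; apply: eq_bigr => -[i /=]; rewrite ltnS => le_im _.
by rewrite !fps_trunc_coef // ?(leq_trans _ le_mn) // leq_subr.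
Qed.

Lemma eq_fps_mul f f' g g' : f =1 f' -> g =1 g' -> fps_mul f g =1 fps_mul f' g'.
Proof. by move=> ff gg n; apply: eq_bigr => i _; rewrite ff gg. Qed.

Lemma fps_mulC f g : fps_mul f g =1 fps_mul g f.
Proof. by move=> n; rewrite !(@fps_mul_trunc n) // mulrC. Qed.

Lemma fps_mulA f g h : fps_mul f (fps_mul g h) =1 fps_mul (fps_mul f g) h.
Proof.
move=> n; set tr := fps_trunc n.
transitivity ((tr f * (tr g * tr h))`_n).
  rewrite coefM; apply: eq_bigr => -[i /=]; rewrite ltnS => le_in _.
  by rewrite fps_trunc_coef // (@fps_mul_trunc n) // leq_subr.
rewrite mulrA coefM; apply: eq_bigr => -[i /=]; rewrite ltnS => le_in _.
by rewrite (@fps_mul_trunc n) // fps_trunc_coef // leq_subr.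
Qed.

Lemma fps_mul1 f : fps_mul f (fps_one F) =1 f.
Proof.
move=> n; rewrite fps_mulC /fps_mul big_ord_recl /= mul1r subn0 big1 ?addr0 // => i _.
by rewrite mul0r.
Qed.

Lemma fps_divE f g h : g 0%N != 0 -> h =1 fps_mul f g -> fps_div h g =1 f.
Proof.
move=> g0 hE n; rewrite /fps_div (eq_fps_mul hE (fun=> erefl)) -fps_mulA.
by rewrite (eq_fps_mul (fun=> erefl) (fps_mulV g0)) fps_mul1.
Qed.

(* the derivation [x d/dx], whose Leibniz rule needs no reindexing *)
Definition fps_theta f : fps F := fun n => n%:R * f n.

Lemma fps_thetaM f g :
  fps_theta (fps_mul f g) =1
  fun n => fps_mul (fps_theta f) g n + fps_mul f (fps_theta g) n.
Proof.
move=> n; rewrite /fps_theta /fps_mul big_distrr -big_split /=.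
apply: eq_bigr => -[i /=]; rewrite ltnS => le_in _.
rewrite -{1}(subnKC le_in) natrD mulrDl mulrA; congr (_ + _).
by rewrite mulrCA.
Qed.

Lemma fps_theta_pow f k :
  fps_theta (fps_pow f k.+1) =1
  fun n => k.+1%:R * fps_mul (fps_theta f) (fps_pow f k) n.
Proof.
elim: k => [|k IHk] n.
  rewrite mul1r /fps_pow /= fps_thetaM [X in _ + X]big1 ?addr0 // => i _.
  by rewrite /fps_theta /fps_one; case: (_ - _)%N => [|m]; rewrite ?mul0r !mulr0.
rewrite {1}/fps_pow iterS fps_thetaM -/(fps_pow f k.+1).
rewrite (eq_fps_mul (fun=> erefl) IHk).
have -> : fps_mul f (fun n => k.+1%:R * fps_mul (fps_theta f) (fps_pow f k) n) n =
    k.+1%:R * fps_mul (fps_theta f) (fps_pow f k.+1) n.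
  transitivity (k.+1%:R * fps_mul f (fps_mul (fps_theta f) (fps_pow f k)) n).
    by rewrite [in RHS]/fps_mul big_distrr /=; apply: eq_bigr => i _; rewrite mulrCA.
  congr (_ * _); rewrite fps_mulA (eq_fps_mul (fps_mulC _ _) (fun=> erefl)).
  by rewrite -fps_mulA.
by rewrite -{1}[fps_mul _ _ n]mul1r -mulrDl nat1r.
Qed.

End FpsTheory.

Lemma fps_exp0 (g : fps rat) : fps_exp g 0%N = 1.
Proof. by rewrite /fps_exp big_ord1 /= /fps_one /= fact0 divr1. Qed.

(** Termwise, [fps_theta] sends [g ^ k.+1 / k.+1!] to [fps_theta g] times [g ^ k / k!]. *)
Lemma fps_theta_exp (g : fps rat) : g 0%N = 0 ->
  fps_theta (fps_exp g) =1 fps_mul (fps_theta g) (fps_exp g).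
Proof.
move=> g0 n.
(* The cut-off in [fps_exp] varies with the index; since [g 0 = 0], all indices up to [n] can share
   the bound [n]. *)
have expE m : (m <= n)%N -> fps_exp g m = \sum_(k < n.+1) fps_pow g k m / k`!%:R.
  move=> le_mn; rewrite /fps_exp.
  rewrite (big_ord_widen n.+1 (fun k => fps_pow g k m / k`!%:R)) //.
  rewrite big_mkcond; apply: eq_bigr => k _; case: ltnP => // lt_mk.
  by rewrite fps_pow_small ?mul0r.
rewrite /fps_theta expE // big_ord_recl /= mulrDr [X in X + _](_ : _ = 0); last first.
  by rewrite /fps_one; case: n {expE} => [|n]; rewrite ?mul0r ?mulr0.
rewrite add0r -/(fps_theta _) /fps_mul.
under [RHS]eq_bigr => i _ do rewrite expE ?leq_subr // big_distrr.
(* On the right the summand [k = n] vanishes: [fps_theta g] is zero at [0], and [g ^ n] has no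
   coefficient below [n]. *)
rewrite exchange_big /= [RHS]big_ord_recr /= [X in _ + X]big1 ?addr0; last first.
  move=> i _; have [->|i_gt0] := posnP i; first by rewrite /fps_theta !mul0r.
  by rewrite fps_pow_small ?mul0r ?mulr0 // ltn_subrL i_gt0 (leq_trans i_gt0) // -ltnS.
rewrite big_distrr; apply: eq_bigr => k _ /=.
have := fps_theta_pow g k n; rewrite {1}/fps_theta mulrA => ->.
rewrite factS natrM invfM mulrACA mulfV ?pnatr_eq0 // mul1r.
by rewrite /fps_mul big_distrl /=; apply: eq_bigr => i _; rewrite mulrA.
Qed.

(** The recurrence is the equation [fps_theta e = fps_theta g * e], which in characteristic zero
    determines [e n] from the earlier coefficients. *)
Lemma fps_expP (g e : fps rat) : g 0%N = 0 -> e 0%N = 1 ->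
  (forall n, n%:R * e n = \sum_(1 <= r < n.+1) r%:R * g r * e (n - r)%N) ->
  e =1 fps_exp g.
Proof.
move=> g0 e0 eE; elim/ltn_ind => -[|n] IHn; first by rewrite e0 fps_exp0.
apply: (@mulfI _ n.+1%:R); first by rewrite pnatr_eq0.
rewrite eE; have := fps_theta_exp g0 n.+1; rewrite {1}/fps_theta => ->.
rewrite /fps_mul big_ord_recl {1}/fps_theta !mul0r add0r big_add1 big_mkord.
by apply: eq_bigr => i _; rewrite IHn // subSS ltnS leq_subr.
Qed.

(** * Multisets stable under a map with finite orbits *)

Lemma card_fsetM (T U : choiceType) (A : {fset T}) (B : {fset U}) :
  #|` (A `*` B)%fset|%fset = (#|` A|%fset * #|` B|%fset)%N.
Proof.
rewrite -(size_allpairs pair); apply/perm_size/uniq_perm => [//||[x y]].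
  by apply: allpairs_uniq => // -[x y] [x' y'] _ _ [-> ->].
by rewrite in_fsetM; apply/andP/allpairsP => [[xA yB]|[[? ?] [? ? [-> ->]]]//];
  exists (x, y).
Qed.

Section StableMultisets.
Local Open Scope nat_scope.
Variables (T : choiceType) (F : T -> T) (X : T -> Prop).
Hypothesis F_inj : injective F.
Hypothesis X_F : forall p, X p -> X (F p).
Hypothesis X_periodic : forall p, X p -> exists2 r, 0 < r & iter r F p = p.

(** For injective [F] and finite [A], the second condition is equivalent to [F] mapping [A] onto
    itself. *)
Definition stable_fset (A : {fset T}) :=
  (forall p, p \in A -> X p) /\ (forall p, (F p \in A) = (p \in A)).
Definition stable_mset (M : {mset T}%mset) :=
  (forall p, p \in M -> X p) /\ (forall p, M (F p) = M p).

Definition stable_fsets n : {fset {fset T}} :=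
  fset_set [set A : {fset T} | #|` A|%fset = n /\ stable_fset A]%classic.
Definition stable_msets n : {fset {mset T}%mset} :=
  fset_set [set M : {mset T}%mset | size M = n /\ stable_mset M]%classic.

Variable Fix : nat -> {fset T}.
Hypothesis in_Fix : forall r p, 0 < r ->
  p \in Fix r <-> X p /\ iter r F p = p.

Local Notation NS := stable_fsets.
Local Notation MS := stable_msets.

Lemma size_msetD (A B : {mset T}%mset) : size (msetD A B) = size A + size B.
Proof.
rewrite -size_cat; apply/perm_size/eq_seq_msetP/msetP => a.
by rewrite !mset_seqE count_cat !count_mem_mset msetE2.
Qed.

Lemma iter_inj r : injective (iter r F).
Proof. by elim: r => // r IHr p q /F_inj /IHr. Qed.

(** A nonzero remainder of [n] modulo the least period would be a smaller period. *)
Lemma order_exists p : X p ->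
  exists2 d, 0 < d & forall n, (iter n F p == p) = (d %| n).
Proof.
move=> /X_periodic [r r_gt0 rE].
have exP : exists m, (0 < m) && (iter m F p == p) by exists r; rewrite r_gt0 rE eqxx.
case: (ex_minnP exP) => d /andP[d_gt0 /eqP dE] d_min; exists d => // n.
have iter_mul m : iter (m * d) F p = p.
  by elim: m => // m IHm; rewrite mulSn iterD IHm.
rewrite {1}(divn_eq n d) addnC iterD iter_mul /dvdn.
have [->|m_gt0] := posnP (n %% d); first by rewrite /= !eqxx.
apply/negbTE/negP => mE.
by have := d_min _ (introT andP (conj m_gt0 mE)); rewrite leqNgt ltn_pmod.
Qed.

(** * Orbits as multisets *)

Section Orbit.
Variables (p : T) (d : nat).
Hypotheses (d_gt0 : 0 < d) (dP : forall n, (iter n F p == p) = (d %| n)).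

Definition orbit_mset : {mset T}%mset := seq_mset (traject F p d).

Lemma uniq_traject_order : uniq (traject F p d).
Proof.
have lt_neq i j : i < j -> j < d -> iter i F p != iter j F p.
  move=> lt_ij lt_jd; apply/eqP; rewrite -(subnKC (ltnW lt_ij)) iterD.
  move=> /iter_inj /esym /eqP; rewrite dP => /(dvdn_leq _).
  rewrite subn_gt0 lt_ij => /(_ isT) /leq_trans /(_ (leq_subr _ _)).
  by rewrite leqNgt lt_jd.
apply/(uniqP p) => i j; rewrite !inE size_traject => lt_id lt_jd.
rewrite !nth_traject //; case: (ltngtP i j) => // lt_ij ijE.
  by have := lt_neq _ _ lt_ij lt_jd; rewrite ijE eqxx.
by have := lt_neq _ _ lt_ij lt_id; rewrite ijE eqxx.
Qed.

Lemma orbit_msetE a : orbit_mset a = (a \in traject F p d).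
Proof. by rewrite mset_seqE count_uniq_mem // uniq_traject_order. Qed.

Lemma orbit_mset_id : orbit_mset p = 1.
Proof. by rewrite orbit_msetE; case: d d_gt0 => // n _; rewrite inE eqxx. Qed.

Lemma size_orbit_mset : size orbit_mset = d.
Proof. by rewrite (perm_size (perm_eq_seq_mset _)) size_traject. Qed.

Lemma orbit_mset_stable a : orbit_mset (F a) = orbit_mset a.
Proof.
have Fd : iter d F p = p by apply/eqP; rewrite dP.
rewrite !orbit_msetE; congr (nat_of_bool _).
apply/trajectP/trajectP => [[[|i] lt_id]|[i lt_id ->]].
(* [F a] is the starting point, so [a] is the last iterate of the cycle. *)
- rewrite /= => FaE; exists d.-1; first by rewrite ltn_predL.
  by apply: F_inj; rewrite FaE -iterS prednK.
- by rewrite iterS => /F_inj ->; exists i => //; exact: ltnW.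
- have [lt_i|] := ltnP i.+1 d; first by exists i.+1.
  move=> le_di; have {le_di} iE : i.+1 = d by apply/eqP; rewrite eqn_leq lt_id.
  by exists 0 => //; rewrite -iterS iE Fd.
Qed.

Lemma mem_orbit_iter M a : stable_mset M -> p \in M -> a \in traject F p d -> M a = M p.
Proof.
move=> [_ MF] pM /trajectP[i _ ->].
by elim: i => //= i; rewrite MF.
Qed.

Lemma orbit_mset_sub M : stable_mset M -> p \in M -> msubset orbit_mset M.
Proof.
move=> stM pM; apply/msubsetP => a; rewrite orbit_msetE.
by case: (boolP (a \in _)) => // a_in; rewrite (mem_orbit_iter stM pM a_in) mset_gt0.
Qed.

Lemma leq_order_size M : stable_mset M -> p \in M -> d <= size M.
Proof.
move=> stM pM; rewrite -(msetBDKC (orbit_mset_sub stM pM)) size_msetD.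
by rewrite size_orbit_mset leq_addr.
Qed.

End Orbit.

(** * Finiteness and double counting of stable multisets *)

Definition short_orbits n : {fset T} := (\bigcup_(r <- iota 1 n) Fix r)%fset.

Lemma in_short_orbits n p : p \in short_orbits n -> X p.
Proof.
move=> /bigfcupP[r]; rewrite mem_iota andbT => /andP[r_gt0 _].
by move=> /(in_Fix _ r_gt0)[].
Qed.

(** A stable multiset contains the whole orbit of each of its elements, so these orbits are no
    longer than its size. This confines all stable multisets of a given size to one finite
    support. *)
Lemma stable_mset_short (M : {mset T}%mset) p :
  stable_mset M -> p \in M -> p \in short_orbits (size M).
Proof.
move=> stM pM; apply/bigfcupP; have [d d_gt0 dP] := order_exists (stM.1 _ pM).
exists d; first by rewrite mem_iota d_gt0 add1n ltnS (leq_order_size dP).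
by apply/in_Fix => //; split; [exact: stM.1|apply/eqP; rewrite dP].
Qed.

Lemma stable_seq_mset (A : {fset T}) : stable_fset A -> stable_mset (seq_mset A).
Proof.
move=> [XA AF]; split=> p; first by rewrite (perm_mem (perm_eq_seq_mset _)); apply: XA.
by rewrite !mset_seqE !count_uniq_mem // AF.
Qed.

Lemma in_stable_fsets n (A : {fset T}) :
  A \in NS n <-> #|` A|%fset = n /\ stable_fset A.
Proof.
rewrite in_fset_set ?inE //.
apply: (@finite_subfset _ (fpowerset (short_orbits n))) => B [<- stB] /=.
rewrite fpowersetE; apply/fsubsetP => p pB.
rewrite -(perm_size (perm_eq_seq_mset B)); apply: stable_mset_short.
  exact: stable_seq_mset.
by rewrite (perm_mem (perm_eq_seq_mset _)).
Qed.

(** [fset_set] is faithful on finite sets; here finiteness holds because every such multiset comes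
    from an [n]-tuple over [short_orbits n]. *)
Lemma in_stable_msets n (M : {mset T}%mset) :
  M \in MS n <-> size M = n /\ stable_mset M.
Proof.
rewrite in_fset_set ?inE //.
pose Y := short_orbits n.
apply: (@sub_finite_set _ _ [set seq_mset (map val (t : n.-tuple Y)) | t in setT]%classic).
  move=> B [szB stB] /=; have allB : all (mem Y) B.
    by apply/allP => p pB; rewrite /= /Y -szB; apply: stable_mset_short.
  have valE : map val (pmap (insub : T -> option Y) B) = B.
    by rewrite (pmap_filter (insubK _)) (eq_filter (isSome_insub _)); apply/all_filterP.
  have sz : size (pmap (insub : T -> option Y) B) == n by rewrite -(size_map val) valE szB.
  by exists (Tuple sz) => //=; rewrite valE seq_mset_id.
exact/finite_image/finite_finset.
Qed.

Lemma MS_containing p d n :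
  0 < d -> (forall n, (iter n F p == p) = (d %| n)) -> X p -> d <= n ->
  [fset M in MS n | p \in (M : {mset T}%mset)]%fset =
  [fset msetD (orbit_mset p d) M | M in MS (n - d)]%fset.
Proof.
move=> d_gt0 dP Xp le_dn; have XF i : X (iter i F p) by elim: i => //= i; apply: X_F.
apply/fsetP => M; rewrite !inE /=; apply/andP/imfsetP.
  move=> [/in_stable_msets[szM stM] pM]; have sub := orbit_mset_sub dP stM pM.
  exists (msetB M (orbit_mset p d)); last by rewrite msetBDKC.
  apply/in_stable_msets; split; last split.
  - rewrite -szM -{2}(msetBDKC sub) size_msetD size_orbit_mset addKn //.
  - by move=> q; rewrite in_msetB => /(leq_ltn_trans (leq0n _)); rewrite mset_gt0 => /stM.1.
  - by move=> q; rewrite !msetE2 (orbit_mset_stable d_gt0 dP) stM.2.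
move=> [M' /in_stable_msets[szM [XM MF]] ->]; split; last first.
  by rewrite in_msetD -mset_gt0 (orbit_mset_id d_gt0 dP).
apply/in_stable_msets; split; last split.
- by rewrite size_msetD size_orbit_mset szM subnKC.
- move=> q; rewrite in_msetD => /orP[|/XM//].
  by rewrite -mset_gt0 (orbit_msetE dP) lt0b => /trajectP[i _ ->].
- by move=> q; rewrite !msetE2 (orbit_mset_stable d_gt0 dP) MF.
Qed.

(** Both sides satisfy the same recursion from [n - d] to [n], where [d] is the orbit length of [p]:
    removing one copy of the orbit lowers the multiplicity of [p] by one. *)
Lemma sum_mult p n : X p ->
  \sum_(M <- MS n) (M : {mset T}%mset) p =
  \sum_(1 <= r < n.+1 | iter r F p == p) #|` MS (n - r)|%fset.
Proof.
move=> Xp; have [d d_gt0 dP] := order_exists Xp.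
under [RHS]eq_bigl => r do rewrite dP.
elim/ltn_ind: n => n IHn; have [lt_nd|le_dn] := ltnP n d.
  (* Both sides vanish: a stable multiset containing [p] has at least [d] elements, and no positive
     [r <= n] is a multiple of [d]. *)
  rewrite [LHS]big_seq [LHS]big1 => [|M /in_stable_msets[szM stM]]; last first.
    apply/mset_eq0P/negP => /(leq_order_size dP stM).
    by rewrite szM leqNgt lt_nd.
  rewrite big_nat_cond big1 // => r /andP[/andP[r_gt0]].
  rewrite ltnS => le_rn /(dvdn_leq r_gt0).
  by rewrite leqNgt (leq_ltn_trans le_rn lt_nd).
transitivity (\sum_(M <- [fset M in MS n | p \in (M : {mset T}%mset)]%fset) (M : {mset T}%mset) p).
  rewrite -big_fset_condE [LHS](bigID (fun M : {mset T}%mset => p \in M)) /=.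
  by rewrite [X in _ + X]big1 ?addn0 // => M /mset_eq0P.
rewrite (MS_containing d_gt0 dP Xp le_dn) big_imfset /=; last first.
  by move=> M1 M2 _ _ /(can_inj (@msetDKB _ _)).
under eq_bigr => M _ do rewrite msetE2 (orbit_mset_id d_gt0 dP).
rewrite big_split /= -card_fset_sum1 IHn; last by rewrite ltn_subrL d_gt0 (leq_trans d_gt0).
(* Among the positive multiples of [d], the first, [r = d], counts the multisets of size [n - d];
   the others are shifted down by [d]. *)
rewrite [RHS](@big_cat_nat _ _ _ d) //=; last exact: leqW.
rewrite [X in _ = X + _]big_nat_cond [X in _ = X + _]big1 ?add0n; last first.
  move=> r /andP[/andP[r_gt0 lt_rd] /(dvdn_leq r_gt0)].
  by rewrite leqNgt lt_rd.
rewrite [RHS]big_ltn_cond ?ltnS // dvdnn; congr (_ + _).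
rewrite -[d.+1]add1n big_addn subSn //; apply: eq_big => r.
  by rewrite dvdn_addl.
by move=> _; rewrite addnC subnDA.
Qed.

Lemma stable_mset_recurrence n :
  n * #|` MS n|%fset = \sum_(1 <= r < n.+1) #|` Fix r|%fset * #|` MS (n - r)|%fset.
Proof.
(* [Y] contains the supports of all these multisets and every [Fix r] with [1 <= r <= n], so both
   orders of summation can use it. *)
pose Y := short_orbits n.
transitivity (\sum_(M <- MS n) \sum_(p <- Y) (M : {mset T}%mset) p).
  rewrite card_fset_sum1 big_distrr big_seq [RHS]big_seq /=.
  apply: eq_bigr => M /in_stable_msets[szM stM]; rewrite muln1 -szM size_mset.
  apply/big_fset_incl => [|p _]; last by rewrite msuppE => /mset_eq0P.
  by apply/fsubsetP => p; rewrite msuppE /Y -szM; apply: stable_mset_short.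
rewrite exchange_big big_seq /=.
under eq_bigr => p pY do rewrite (sum_mult _ (in_short_orbits pY)) big_mkcond.
rewrite -big_seq exchange_big /= big_nat_cond [RHS]big_nat_cond /=.
apply: eq_bigr => r; rewrite andbT => /andP[r_gt0 le_rn].
rewrite -big_mkcond /= big_fset_condE card_fset_sum1 big_distrl /=.
rewrite (_ : [fset _ in Y | _]%fset = Fix r); first by under [RHS]eq_bigr do rewrite mul1n.
apply/fsetP => p; rewrite !inE /=; apply/andP/idP => [[/in_short_orbits Xp /eqP rE]|].
  exact/in_Fix.
move=> p_r; split; last by move/in_Fix: p_r => [] // _ ->.
by apply/bigfcupP; exists r => //; rewrite mem_iota andbT r_gt0.
Qed.

(** * Splitting multiplicities by parity *)

Definition odd_part (M : {mset T}%mset) := [fset p in M | odd (M p)]%fset.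
Definition half_mset (M : {mset T}%mset) : {mset T}%mset :=
  [fsfun p in finsupp M => (M p)./2]%fmap.
Definition join_parity (A : {fset T}) (M : {mset T}%mset) : {mset T}%mset :=
  msetD (seq_mset A) (msetD M M).

Lemma in_odd_part M p : (p \in odd_part M) = odd (M p).
Proof. by rewrite !inE /= -mset_gt0; case: (M p). Qed.

Lemma half_msetE M p : half_mset M p = (M p)./2.
Proof. by rewrite fsfunE msuppE; case: ifPn => // /mset_eq0P ->. Qed.

Lemma join_parityE A M p : join_parity A M p = (p \in A) + (M p).*2.
Proof. by rewrite !msetE2 mset_seqE count_uniq_mem // addnn. Qed.

Lemma size_join_parity A M : size (join_parity A M) = #|` A|%fset + (size M).*2.
Proof. by rewrite !size_msetD addnn (perm_size (perm_eq_seq_mset _)). Qed.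

Lemma join_parityK M : join_parity (odd_part M) (half_mset M) = M.
Proof.
by apply/msetP => p; rewrite join_parityE in_odd_part half_msetE odd_double_half.
Qed.

Lemma odd_part_join A M : odd_part (join_parity A M) = A.
Proof.
by apply/fsetP => p; rewrite in_odd_part join_parityE oddD odd_double addbF oddb.
Qed.

Lemma half_mset_join A M : half_mset (join_parity A M) = M.
Proof. by apply/msetP => p; rewrite half_msetE join_parityE half_bit_double. Qed.

Lemma join_parity_stable A M :
  stable_mset (join_parity A M) <-> stable_fset A /\ stable_mset M.
Proof.
split=> [[XJ JF]|[[XA AF] [XM MF]]]; last first.
  split=> p; last by rewrite !join_parityE AF MF.
  rewrite -mset_gt0 join_parityE addn_gt0 lt0b double_gt0 mset_gt0.
  by case/orP => [/XA|/XM].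
split; split=> p.
- by move=> pA; apply: XJ; rewrite -mset_gt0 join_parityE pA.
- by rewrite -(odd_part_join A M) !in_odd_part JF.
- move=> pM; apply: XJ; rewrite -mset_gt0 join_parityE addn_gt0 double_gt0.
  by rewrite mset_gt0 pM orbT.
- by rewrite -(half_mset_join A M) !half_msetE JF.
Qed.

(** [join_parity] is injective on pairs, with inverse given by [odd_part] and [half_mset]; sizes add
    up to [i] plus an even number, which excludes odd [n - i]. *)
Lemma MS_odd_part n i :
  i <= n ->
  #|` [fset M in MS n | #|` odd_part M| == i]%fset|%fset =
  if odd (n - i) then 0 else #|` NS i|%fset * #|` MS (n - i)./2|%fset.
Proof.
move=> le_in; case: ifPn => odd_ni.
  apply/eqP; rewrite cardfs_eq0 -fsubset0; apply/fsubsetP => M.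
  rewrite !inE /= => /andP[/in_stable_msets[szM _] /eqP oddM].
  by move: odd_ni; rewrite -szM -(join_parityK M) size_join_parity
     oddM addKn odd_double.
have nE : i + ((n - i)./2).*2 = n by rewrite even_halfK // subnKC.
transitivity #|` [fset join_parity AM.1 AM.2 |
                   AM in (NS i `*` MS (n - i)./2)]%fset|%fset; last first.
  rewrite -card_fsetM; apply: card_in_imfset => -[A M] [A' M'] _ _ /= eqJ.
  congr (_, _); first by rewrite -(odd_part_join A M) eqJ odd_part_join.
  by rewrite -(half_mset_join A M) eqJ half_mset_join.
congr #|` _|%fset; apply/fsetP => M; rewrite !inE /=; apply/andP/imfsetP.
  move=> [/in_stable_msets[szM stM] /eqP oddM]; exists (odd_part M, half_mset M).
    move: stM; rewrite -{1}(join_parityK M) => /join_parity_stable[stA stM].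
    rewrite in_fsetM /=; apply/andP; split; first exact/in_stable_fsets.
    apply/in_stable_msets; split=> //; rewrite -szM -{2}(join_parityK M).
    by rewrite size_join_parity oddM addKn doubleK.
  by rewrite join_parityK.
move=> [[A M']]; rewrite in_fsetM => /andP[/= /in_stable_fsets[cardA stA] /in_stable_msets[szM stM]] ->.
rewrite odd_part_join cardA eqxx; split=> //; apply/in_stable_msets; split.
  by rewrite size_join_parity cardA szM.
exact/join_parity_stable.
Qed.

(** The coefficient form of [fbar x = f x * fbar (x ^ 2)]; the divisibility test matches
    [fps_subXn 2]. *)
Lemma stable_mset_parity n :
  #|` MS n|%fset =
  \sum_(i < n.+1) #|` NS i|%fset *
    (if 2 %| n - i then #|` MS ((n - i) %/ 2)|%fset else 0).
Proof.
rewrite card_fset_sum1 big_seq.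
(* [inord] loses nothing, since the odd part of a multiset of size [n] has at most [n] elements. *)
rewrite (partition_big (fun M => inord #|` odd_part M|%fset) (fun i : 'I_n.+1 => true)) //=.
apply: eq_bigr => i _; rewrite dvdn2 divn2.
transitivity #|` [fset M in MS n | #|` odd_part M| == i]%fset|%fset; last first.
  by rewrite MS_odd_part ?leq_ord //; case: odd; rewrite ?muln0.
rewrite card_fset_sum1 -big_fset_condE [RHS]big_seq_cond.
apply: eq_bigl => M; case: (boolP (M \in MS n)) => //= /in_stable_msets[szM _].
rewrite -val_eqE /= inordK // ltnS -szM -{2}(join_parityK M).
by rewrite size_join_parity leq_addr.
Qed.

End StableMultisets.

(** * The Frobenius and the Galois group *)

Lemma map_traject (T : Type) (f : T -> T) x n :
  map f (traject f x n) = traject f (f x) n.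
Proof. by elim: n x => //= n IHn x; rewrite IHn. Qed.

Section Frobenius.
Variables (k : finFieldType) (K : closedFieldType) (iota : {rmorphism k -> K}).
Local Notation q := #|k|.

(** The morphism argument lets the ring morphism instances below, whose proofs need [k] to embed in
    [K], attach to this function. *)
Definition frobenius of {rmorphism k -> K} := fun x : K => x ^+ q.
Local Notation phi := (frobenius iota).

Lemma pchar_card : exists p e, [/\ prime p, p \in [pchar K] & q = (p ^ e.+1)%N].
Proof.
have [p p_pr pchark] := finPcharP k.
have := card_pprimeChar pchark; case: (logn _ _) => [|e] qE.
  by have := finNzRing_gt1 k; rewrite qE.
by exists p, e; rewrite (fmorph_pchar iota).
Qed.

Lemma pchar_nat_card : [pchar K].-nat q.
Proof.
have [p [e [p_pr pcharK ->]]] := pchar_card.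
by rewrite pnatX pnatE // pcharK.
Qed.

Lemma natr_card : q%:R = 0 :> K.
Proof.
have [p [e [p_pr pcharK ->]]] := pchar_card.
by apply/eqP; rewrite -(dvdn_pcharf pcharK) expnS dvdn_mulr.
Qed.

Lemma exprB_card_power r (x y : K) : (x - y) ^+ (q ^ r) = x ^+ (q ^ r) - y ^+ (q ^ r).
Proof.
by apply/eqP; rewrite eq_sym subr_eq -exprDn_pchar ?subrK // pnatX pchar_nat_card.
Qed.

Lemma frobenius_zmod_morphism : zmod_morphism phi.
Proof. by move=> x y; rewrite /frobenius -(expn1 q) exprB_card_power. Qed.

Lemma frobenius_monoid_morphism : monoid_morphism phi.
Proof. by split=> [|x y]; rewrite /frobenius ?expr1n ?exprMn. Qed.

HB.instance Definition _ :=
  GRing.isZmodMorphism.Build K K phi frobenius_zmod_morphism.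
HB.instance Definition _ :=
  GRing.isMonoidMorphism.Build K K phi frobenius_monoid_morphism.

Lemma card_gt1 : (1 < q)%N.
Proof. exact: finNzRing_gt1. Qed.

Lemma iter_frobenius r x : iter r phi x = x ^+ (q ^ r).
Proof. by elim: r => //= r ->; rewrite /frobenius -exprM -expnSr. Qed.

Lemma frobenius_iota a : phi (iota a) = iota a.
Proof. by rewrite /frobenius -rmorphXn expf_card. Qed.

(** Over [K], ['X^q - 'X] is the product of the ['X - iota a]; at a fixed [x] one factor must
    vanish. *)
Lemma frobenius_fixed x : phi x = x -> exists a, x = iota a.
Proof.
move=> xE; have := congr1 (map_poly iota) (finField_genPoly k).
rewrite rmorphB /= map_polyXn map_polyX map_prod_XsubC => /(congr1 (fun P => P.[x])).
rewrite hornerD hornerN hornerXn hornerX -/(phi x) xE subrr horner_prod.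
by move/esym/eqP/prodf_eq0 => [a _]; rewrite hornerXsubC subr_eq0 => /eqP; exists a.
Qed.

Lemma frobenius_bij : bijective phi.
Proof.
have phi_surj x : exists y, phi y == x.
  (* The monic equation solved is [y ^ q = x]: the lower coefficients are [x] at index [0] and zero
     elsewhere. *)
  have [y] := @solve_monicpoly K q (fun i => x *+ (i == 0%N)) (ltnW card_gt1).
  rewrite -(big_mkord xpredT (fun i => x *+ (i == 0%N) * y ^+ i)).
  rewrite big_ltn ?(ltnW card_gt1) // mulr1 big_nat_cond big1 ?addr0 => [yE|].
    by exists y; rewrite /frobenius yE.
  by move=> [|i] // _; rewrite mulr0n mul0r.
exists (fun x => xchoose (phi_surj x)) => x; last exact/eqP/(xchooseP (phi_surj x)).
by apply: (fmorph_inj phi); apply/eqP/(xchooseP (phi_surj (phi x))).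
Qed.

Lemma frobenius_in_Gal : in_Gal iota phi.
Proof. by split; [exact: frobenius_bij|exact: frobenius_iota]. Qed.

(** All iterates of [x] are roots of one nonzero polynomial over [k], so two of them coincide;
    injectivity of [phi] turns this repetition into a period. *)
Lemma algebraic_periodic x : algebraicOver iota x ->
  exists2 r, (0 < r)%N & iter r phi x = x.
Proof.
move=> [P P0 Px]; set Q := map_poly iota P in Px.
have Q0 : Q != 0 by rewrite map_poly_eq0.
have rootQ i : root Q (iter i phi x).
  elim: i => //= i IHi; have -> : Q = map_poly phi Q.
    by rewrite /Q -map_poly_comp; apply: eq_map_poly => a /=; rewrite frobenius_iota.
  by rewrite fmorph_root.
have /negP/negP : ~~ uniq (traject phi x (size Q)).
  apply/negP => /(max_poly_roots Q0); rewrite size_traject ltnn => /(_ _)/negP; apply=> //.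
  by apply/allP => _ /trajectP[i _ ->].
case: (size Q) => // n; rewrite looping_uniq negbK => /trajectP[i lt_in iE].
exists (n - i)%N; first by rewrite subn_gt0.
have inj j : injective (iter j phi) by elim: j => //= j IHj y z /fmorph_inj /IHj.
by apply: (inj i); rewrite -iterD subnKC // ltnW.
Qed.

Lemma frobenius_periodicM r d x : iter r phi x = x -> iter (d * r) phi x = x.
Proof. by move=> rE; elim: d => // d IHd; rewrite mulSn iterD IHd. Qed.

Lemma fixed_field_enum r : (0 < r)%N ->
  {E : seq K | [/\ uniq E, size E = (q ^ r)%N &
                  forall x, (x \in E) = (iter r phi x == x)]}.
Proof.
move=> r_gt0; set n := (q ^ r)%N.
have n_gt1 : (1 < n)%N by rewrite -(exp1n r) ltn_exp2r ?card_gt1.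
have [E PE] := closed_field_poly_normal ('X^n - 'X : {poly K}).
have szP : size ('X^n - 'X : {poly K}) = n.+1.
  by rewrite size_polyDl ?size_polyXn // size_polyN size_polyX ltnS.
have lead1 : lead_coef ('X^n - 'X : {poly K}) = 1.
  by rewrite lead_coefDl ?lead_coefXn // size_polyXn size_polyN size_polyX ltnS.
rewrite lead1 scale1r in PE; exists E; split.
(* The derivative is [-1], because [q ^ r] is zero in [K] for [r > 0]; hence the roots are
   simple. *)
- rewrite -separable_prod_XsubC -PE unlock derivB derivXn derivX.
  rewrite -mulr_natr -polyC_natr natrX natr_card expr0n (gtn_eqF r_gt0).
  by rewrite rmorph0 mulr0 sub0r -[- 1]scaleN1r coprimepZr ?oppr_eq0 ?oner_eq0 ?coprimep1.
- by apply: succn_inj; rewrite -szP PE size_prod_XsubC.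
- move=> x; rewrite -root_prod_XsubC -PE /root hornerD hornerN hornerXn hornerX.
  by rewrite subr_eq0 iter_frobenius.
Qed.

(** Forward, as in Fermat's little theorem: multiplication by a nonzero [x] permutes the nonzero
    elements of [S], and comparing their products gives [x ^ (q ^ r - 1) = 1]. Backward, the fixed
    points of [phi ^ r] form the required subfield. *)
Lemma in_krP r x : (0 < r)%N -> in_kr k r x <-> iter r phi x = x.
Proof.
move=> r_gt0; rewrite iter_frobenius; split=> [[S [cardS [S1 SB Sdiv] xS]]|xE].
  have [->|x0] := eqVneq x 0.
    by rewrite expr0n expn_eq0 (gtn_eqF (ltnW card_gt1)).
  have S0 : 0 \in S by rewrite -(subrr 1) SB.
  have SM y z : y \in S -> z \in S -> y * z \in S.
    move=> yS zS; have := Sdiv y z^-1 yS; rewrite invrK; apply.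
    by have := Sdiv 1 z S1 zS; rewrite mul1r.
  have sub : ([fset x * y | y in (S `\ 0)%fset] `<=` (S `\ 0))%fset.
    apply/fsubsetP => _ /imfsetP[y /= + ->]; rewrite !inE => /andP[y0 yS].
    by rewrite mulf_neq0 ?SM.
  have card_im : #|` [fset x * y | y in (S `\ 0)%fset]|%fset = #|` (S `\ 0)|%fset.
    by apply: card_imfset; apply: mulfI.
  have im_eq : [fset x * y | y in (S `\ 0)%fset]%fset = (S `\ 0)%fset.
    by apply/eqP; rewrite eqEfcard sub card_im leqnn.
  have := congr1 (fun A : {fset K} => \prod_(y <- A) y) im_eq.
  rewrite big_imfset /=; last by move=> y z _ _ /(mulfI x0).
  rewrite big_split /= big_const_seq count_predT iter_mulr_1 => prodE.
  have prod0 : \prod_(y <- (S `\ 0)%fset) y != 0.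
    by rewrite prodf_seq_neq0; apply/allP => y; rewrite !inE => /andP[].
  move: prodE; rewrite -[RHS]mul1r => /(mulIf prod0) xE.
  by rewrite -cardS (cardfsD1 0 S) S0 add1n exprS xE mulr1.
have [E [uE szE memE]] := fixed_field_enum r_gt0.
have inE' y : (y \in [fset y in E]%fset) = (iter r phi y == y).
  by rewrite inE /= memE.
exists [fset y in E]%fset; split.
- by rewrite card_fseq undup_id.
- split=> [|y z|y z]; rewrite !inE' !iter_frobenius.
  + by rewrite expr1n.
  + by rewrite exprB_card_power => /eqP -> /eqP ->.
  + by rewrite exprMn exprVn => /eqP -> /eqP ->.
- by rewrite inE' iter_frobenius xE.
Qed.

(** The nonzero fixed points are [q ^ r - 1] distinct roots of unity of exponent [q ^ r - 1], so one
    of them is primitive. *)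
Lemma fixed_field_generator r : (0 < r)%N -> exists z : K,
  iter r phi z = z /\ forall x, iter r phi x = x -> x = 0 \/ exists m, x = z ^+ m.
Proof.
move=> r_gt0; have [E [uE szE memE]] := fixed_field_enum r_gt0.
set n := (q ^ r).-1.
have n_gt1 : (1 < q ^ r)%N by rewrite -(exp1n r) ltn_exp2r ?card_gt1.
have n_gt0 : (0 < n)%N by rewrite /n -ltnS prednK // ltnW.
have nE x : x ^+ (q ^ r) = x ^+ n * x by rewrite -exprSr prednK // ltnW.
have E0 : 0 \in E by rewrite memE iter_frobenius expr0n (gtn_eqF (ltnW n_gt1)).
have unit_pow x : x != 0 -> iter r phi x = x -> x ^+ n = 1.
  rewrite iter_frobenius nE -[RHS]mul1r => x0 /(mulIf x0) //.
have : has n.-primitive_root (rem 0 E).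
  apply: has_prim_root => //; rewrite ?rem_uniq ?size_rem ?szE //.
  apply/allP => x; rewrite mem_rem_uniq // inE /= memE => /andP[x0 /eqP xE].
  by apply/unity_rootP/unit_pow.
move=> /hasP[z _ z_prim]; exists z; split.
  by rewrite iter_frobenius nE (prim_expr_order z_prim) mul1r.
move=> x; have [->|x0] := eqVneq x 0; first by left.
by move=> /(unit_pow _ x0) /(prim_rootP z_prim)[m ->]; right; exists m.
Qed.

(* The conjugates of a generator [z] of F_{q^r} are its Frobenius iterates, since
   [\prod_(i < r) ('X - z ^ (q ^ i))] has coefficients in [k]. *)
Lemma Gal_frobenius (s : {rmorphism K -> K}) r : in_Gal iota s -> (0 < r)%N ->
  exists j, forall x, iter r phi x = x -> s x = iter j phi x.
Proof.
move=> [_ s_iota] r_gt0; have [z [zr zgen]] := fixed_field_generator r_gt0.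
pose P := \prod_(y <- traject phi z r) ('X - y%:P).
(* Since [phi ^ r] fixes [z], [phi] rotates the list of iterates and so permutes the factors. *)
have phiP : map_poly phi P = P.
  rewrite /P map_prod_XsubC -(big_map phi predT (fun y => 'X - y%:P)).
  apply: perm_big; rewrite -(prednK r_gt0).
  rewrite map_traject trajectSr trajectS.
  rewrite (_ : iter _ _ _ = z) ?perm_rcons //.
  by rewrite -iterSr prednK.
(* Coefficients fixed by [phi] come from [k], where [s] is the identity; thus [s z] is again a root
   of [P]. *)
have sP : map_poly s P = P.
  apply/polyP => i; rewrite coef_map.
  have /frobenius_fixed[a ->] : phi P`_i = P`_i by rewrite -{2}phiP coef_map.
  exact: s_iota.
have : root P (s z).
  rewrite -sP fmorph_root root_prod_XsubC; apply/trajectP.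
  by exists 0%N.
rewrite root_prod_XsubC => /trajectP[j _ szE]; exists j => x /zgen[->|[m ->]].
  by rewrite rmorph0 iter_frobenius expr0n expn_eq0 (gtn_eqF (ltnW card_gt1)).
by rewrite rmorphXn szE !iter_frobenius exprAC.
Qed.

End Frobenius.
(** * Projective points *)

Section Lines.
Variables (K : closedFieldType) (n : nat).
Implicit Types (v w : 'rV[K]_n.+1) (p : {vspace 'rV[K]_n.+1}).

Lemma vline_eqP v w : v != 0 -> <[v]>%VS = <[w]>%VS <-> exists2 c, c != 0 & v = c *: w.
Proof.
move=> v0; split=> [vw|[c c0 ->]].
  have /vlineP[c cE] : v \in <[w]>%VS by rewrite -vw memv_line.
  by exists c => //; apply: contraNneq v0 => c0; rewrite cE c0 scale0r.
apply/eqP; rewrite eqEsubv -!memvE memvZ ?memv_line //=.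
by apply/vlineP; exists c^-1; rewrite scalerA mulVf // scale1r.
Qed.

Lemma line_exists p : \dim p = 1%N -> exists2 v, v != 0 & p = <[v]>%VS.
Proof.
move=> dimp; have v0 : vpick p != 0 by rewrite vpick0 -dimv_eq0 dimp.
exists (vpick p) => //; apply/esym/eqP.
by rewrite eqEdim -memvE memv_pick dimp dim_vline v0.
Qed.

Lemma map_mx_fmorph_inj (s : {rmorphism K -> K}) :
  injective (map_mx s : 'rV[K]_n.+1 -> 'rV[K]_n.+1).
Proof.
move=> v w /rowP vw; apply/rowP => i.
by have := vw i; rewrite !mxE => /fmorph_inj.
Qed.

Lemma map_mx_eq0 (s : {rmorphism K -> K}) v : (map_mx s v == 0) = (v == 0).
Proof. by rewrite -[RHS](inj_eq (@map_mx_fmorph_inj s)) map_mx0. Qed.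

Lemma gal_line_inj (s : {rmorphism K -> K}) v w : bijective s -> v != 0 ->
  gal_line s <[v]>%VS = gal_line s <[w]>%VS -> <[v]>%VS = <[w]>%VS.
Proof.
move=> [t _ tK] v0; rewrite !gal_lineE => /vline_eqP[]; first by rewrite map_mx_eq0.
move=> c c0; rewrite -(tK c) -map_mxZ => /map_mx_fmorph_inj vE.
apply/vline_eqP => //; exists (t c) => //.
by apply: contraNneq v0 => tc0; rewrite vE tc0 scale0r.
Qed.

(* [gal_line] extended by the identity beyond lines, which makes it injective on
   the whole type of subspaces. *)
Definition line_act (s : {rmorphism K -> K}) p := if \dim p == 1%N then gal_line s p else p.

Lemma line_actE (s : {rmorphism K -> K}) v : v != 0 -> line_act s <[v]>%VS = <[map_mx s v]>%VS.
Proof. by move=> v0; rewrite /line_act dim_vline v0 gal_lineE. Qed.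

Lemma dim_line_act s p : \dim (line_act s p) = \dim p.
Proof.
have [/line_exists[v v0 ->]|] := eqVneq (\dim p) 1%N; last first.
  by rewrite /line_act; case: eqP.
by rewrite line_actE // !dim_vline map_mx_eq0.
Qed.

Lemma line_act_inj (s : {rmorphism K -> K}) : bijective s -> injective (line_act s).
Proof.
move=> s_bij p p' pp'; have := dim_line_act s p; rewrite pp' dim_line_act => dimE.
have [dimp|dimp] := eqVneq (\dim p) 1%N; last first.
  by move: pp'; rewrite /line_act dimE (negbTE dimp).
have [[v v0 pE] [w w0 p'E]] := (line_exists dimp, line_exists (etrans dimE dimp)).
move: pp'; rewrite {}pE {}p'E !line_actE // -!gal_lineE; exact: gal_line_inj.
Qed.

Lemma iter_line_act (s : {rmorphism K -> K}) r v : v != 0 ->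
  iter r (line_act s) <[v]>%VS = <[map_mx (iter r s) v]>%VS.
Proof.
move=> v0; suff [] : map_mx (iter r s) v != 0 /\
  iter r (line_act s) <[v]>%VS = <[map_mx (iter r s) v]>%VS by [].
elim: r => [|r [vr0 IHr]]; first by rewrite [map_mx _ _]map_mx_id.
have -> : map_mx (iter r.+1 s) v = map_mx s (map_mx (iter r s) v).
  by apply/matrixP => i j; rewrite !mxE.
by rewrite map_mx_eq0 iterS IHr line_actE.
Qed.

End Lines.

(** * Frobenius and Galois action on the points of [V] *)

Section Points.
Variables (k : finFieldType) (K : closedFieldType) (iota : {rmorphism k -> K}).
Hypothesis HK : is_algebraic_closure iota.
Variable V : quasiproj k.
Local Notation phi := (frobenius iota).
Local Notation pt := (Defs.point K V).
Local Notation X := (@geom_points k K iota V).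

Definition frob_pt : pt -> pt := line_act (phi : {rmorphism K -> K}).
Local Notation F := frob_pt.

Lemma frob_pt_inj : injective F.
Proof. exact/line_act_inj/frobenius_bij. Qed.

Lemma geom_pointP (p : pt) : X p -> exists v, [/\ v != 0, qp_sat iota v & p = <[v]>%VS].
Proof. by move=> [v satv ->]; exists v; split=> //; case: satv. Qed.

Lemma geom_point_dim (p : pt) : X p -> \dim p = 1%N.
Proof. by move=> /geom_pointP[v [v0 _ ->]]; rewrite dim_vline v0. Qed.

Lemma qp_eval_Gal (s : {rmorphism K -> K}) P (v : 'rV[K]_(qp_dim V).+1) :
  (forall a, s (iota a) = iota a) -> qp_eval iota P (map_mx s v) = s (qp_eval iota P v).
Proof.
move=> s_iota; rewrite /qp_eval !mevalE rmorph_sum; apply: eq_bigr => m _.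
rewrite rmorphM rmorph_prod mcoeff_map_mpoly /= s_iota; congr (_ * _).
by apply: eq_bigr => i _; rewrite mxE rmorphXn.
Qed.

Lemma qp_sat_Gal (s : {rmorphism K -> K}) (v : 'rV[K]_(qp_dim V).+1) :
  (forall a, s (iota a) = iota a) -> qp_sat iota v -> qp_sat iota (map_mx s v).
Proof.
move=> s_iota [v0 eqv [Q Qin Qv]]; split; first by rewrite map_mx_eq0.
  by move=> P Pin; rewrite qp_eval_Gal // eqv ?rmorph0.
by exists Q => //; rewrite qp_eval_Gal // fmorph_eq0.
Qed.

Lemma geom_point_frob p : X p -> X (F p).
Proof.
move=> /geom_pointP[v [v0 satv ->]]; rewrite /F line_actE //.
by exists (map_mx phi v) => //; apply: qp_sat_Gal => //; apply: frobenius_iota.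
Qed.

(** Each coordinate is algebraic, hence periodic; the product of the periods serves them all. *)
Lemma row_periodic m (v : 'rV[K]_m) :
  exists2 r, (0 < r)%N & forall i, iter r phi (v 0 i) = v 0 i.
Proof.
have /boolp.choice[f fP] i : exists r, (0 < r)%N /\ iter r phi (v 0 i) = v 0 i.
  by have [r] := algebraic_periodic (HK (v 0 i)); exists r.
exists (\prod_i f i)%N; first by rewrite prodn_gt0 // => i; case: (fP i).
by move=> i; rewrite (bigD1 i) //= mulnC; apply: frobenius_periodicM; case: (fP i).
Qed.

Lemma geom_point_periodic p : X p -> exists2 r, (0 < r)%N & iter r F p = p.
Proof.
move=> /geom_pointP[v [v0 _ ->]]; have [r r_gt0 rE] := row_periodic v.
exists r => //; rewrite /F iter_line_act //; congr <[_]>%VS.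
by apply/rowP => i; rewrite mxE.
Qed.

(** All coordinates of a representative lie in one finite field, on which [s] is a single power of
    Frobenius. The exponent may vary with the point. *)
Lemma gal_line_frob (s : {rmorphism K -> K}) p : in_Gal iota s -> X p ->
  exists j, gal_line s p = iter j F p.
Proof.
move=> s_Gal /geom_pointP[v [v0 _ ->]]; have [r r_gt0 rE] := row_periodic v.
have [j jE] := Gal_frobenius s_Gal r_gt0; exists j.
rewrite gal_lineE /F iter_line_act //; congr <[_]>%VS.
by apply/rowP => i; rewrite !mxE jE.
Qed.

Lemma gal_line_phi p : X p -> gal_line (phi : {rmorphism K -> K}) p = F p.
Proof. by move=> /geom_point_dim dimp; rewrite /F /line_act dimp. Qed.

Lemma rat_pointsP r p : (0 < r)%N ->
  rat_points iota r p <-> X p /\ iter r F p = p.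
Proof.
move=> r_gt0; split=> [[v [satv v_kr ->]]|[Xp]].
  have v0 : v != 0 by case: satv.
  split; first by exists v.
  rewrite /F iter_line_act //; congr <[_]>%VS.
  by apply/rowP => i; rewrite mxE; apply/(in_krP iota).
have [v [v0 satv ->]] := geom_pointP Xp; have [i vi0] := rV0Pn _ v0.
(* A fixed line only gives [phi ^ r w = c w]; normalising one coordinate to [1] will force [c = 1],
   so that every coordinate of [w] is fixed. *)
pose w := (v 0 i)^-1 *: v.
have wi : w 0 i = 1 by rewrite mxE mulVf.
have w0 : w != 0 by apply: contraTneq (oner_neq0 K) => wE; rewrite -wi wE mxE eqxx.
have -> : <[v]>%VS = <[w]>%VS.
  by apply/vline_eqP => //; exists (v 0 i) => //; rewrite scalerA mulfV // scale1r.
rewrite /F iter_line_act // => wE; exists w => //; split.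
  by apply: qp_satZ; rewrite ?invr_eq0.
have iter1 : iter r phi 1 = 1 by rewrite iter_frobenius expr1n.
have wr0 : map_mx (iter r phi) w != 0.
  by apply: contraTneq (oner_neq0 K) => /rowP/(_ i); rewrite !mxE mulVf // iter1 => ->; rewrite eqxx.
have [c c0 cE] := (vline_eqP _ wr0).1 wE.
have c1 : c = 1 by move/rowP/(_ i): cE; rewrite mxE [in RHS]mxE wi iter1 mulr1.
by move=> j; apply/(in_krP iota) => //; move/rowP/(_ j): cE; rewrite c1 scale1r mxE.
Qed.

Lemma rat_points_finite r : (0 < r)%N -> finite_set (rat_points iota r : set pt).
Proof.
move=> r_gt0; have [E [_ _ memE]] := fixed_field_enum iota r_gt0.
pose f (g : {ffun 'I_(qp_dim V).+1 -> 'I_(size E)}) : pt :=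
  <[\row_i E`_(g i)]>%VS.
apply: (@sub_finite_set _ _ [set f g | g in setT]%classic); last first.
  exact/finite_image/finite_finset.
move=> _ [v [_ v_kr] ->].
have vE (i : 'I_(qp_dim V).+1) : (index (v 0%R i) E < size E)%N.
  by rewrite index_mem memE; apply/eqP/in_krP.
exists [ffun i => Ordinal (vE i)] => //; rewrite /f; congr <[_]>%VS.
by apply/rowP => i; rewrite mxE ffunE nth_index // -index_mem.
Qed.

Definition rat_fset r : {fset pt} := fset_set (rat_points iota r : set pt).

Lemma in_rat_fset r p : (0 < r)%N -> p \in rat_fset r <-> X p /\ iter r F p = p.
Proof.
move=> r_gt0; rewrite in_fset_set ?inE; last exact: rat_points_finite.
exact: rat_pointsP.
Qed.

(** Each point moves within its [F]-orbit, so the image lies in [A]; injectivity on lines and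
    finiteness give equality. *)
Lemma gal_line_image (A : {fset pt}) (s : {rmorphism K -> K}) :
  in_Gal iota s -> stable_fset F X A -> [fset gal_line s p | p in A]%fset = A.
Proof.
move=> s_Gal [XA AF].
have sub : ([fset gal_line s p | p in A] `<=` A)%fset.
  apply/fsubsetP => _ /imfsetP[p /= pA ->].
  have [j ->] := gal_line_frob s_Gal (XA _ pA).
  by elim: j => //= j; rewrite AF.
apply/eqP; rewrite eqEfcard sub card_in_imfset //= => p p' /XA + /XA.
move=> /geom_pointP[v [v0 _ ->]] /geom_pointP[w [w0 _ ->]].
by apply: gal_line_inj => //; case: s_Gal.
Qed.

(** Frobenius belongs to the Galois group, which gives one inclusion; the other is
    [gal_line_image]. *)
Lemma rational_nsetsE n :
  rational_nsets iota n = [set A : {fset pt} | #|` A|%fset = n /\ stable_fset F X A]%classic.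
Proof.
apply/seteqP; split=> A /= [cardA]; last first.
  by move=> stA; split=> // [p|s s_Gal]; [exact: stA.1|exact: gal_line_image].
move=> XA /(_ _ (frobenius_in_Gal iota)) phiA; split=> //; split=> // p.
apply/idP/idP => [|pA]; last first.
  rewrite -(gal_line_phi (XA _ pA)).
  by rewrite -[X in _ \in X]phiA; apply/imfsetP; exists p.
rewrite -{1}phiA => /imfsetP[p' /= p'A].
by rewrite (gal_line_phi (XA _ p'A)) => /frob_pt_inj ->.
Qed.

Lemma rational_nmultisetsE n :
  rational_nmultisets iota n =
  [set M : {mset pt}%mset | size M = n /\ stable_mset F X M]%classic.
Proof.
apply/seteqP; split=> M /= [szM].
  move=> XM /(_ _ (frobenius_in_Gal iota)) phiM; split=> //; split=> // p.
  rewrite -{1}phiM mset_seqE count_map -count_mem_mset.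
  apply: eq_in_count => p' p'M /=; rewrite (gal_line_phi (XM _ p'M)).
  exact: (inj_eq frob_pt_inj).
move=> [XM MF]; split=> // s s_Gal; apply/msetP => p.
(* By stability of the support, [s] permutes it; multiplicities then agree because [M] is constant
   along [F]-orbits. *)
have stS : stable_fset F X (finsupp M).
  by split=> p'; rewrite !msuppE => //; [exact: XM|rewrite -!mset_gt0 MF].
rewrite mset_seqE count_map.
have [pM|pM] := boolP (p \in M); last first.
  rewrite (mset_eq0P pM); apply/eqP; rewrite -leqn0 leqNgt -has_count.
  apply: contraNN pM => /hasP[p' p'M /= /eqP <-].
  by rewrite -msuppE -(gal_line_image s_Gal stS); apply/imfsetP; exists p'; rewrite //= msuppE.
move: (pM); rewrite -msuppE -{1}(gal_line_image s_Gal stS) => /imfsetP[p' /=].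
rewrite msuppE => p'M pE.
have [j sE] := gal_line_frob s_Gal (XM _ p'M).
have -> : M p = M p' by rewrite pE sE; elim: j {sE} => //= j; rewrite MF.
rewrite -(count_mem_mset p' M); apply: eq_in_count => p'' p''M /=; rewrite pE.
apply/eqP/eqP => [|-> //].
have [v [v0 _ ->]] := geom_pointP (XM _ p''M); have [w [_ _ ->]] := geom_pointP (XM _ p'M).
by apply: gal_line_inj => //; case: s_Gal.
Qed.

Lemma abar_V_recurrence n :
  (n * abar_V iota V n = \sum_(1 <= r < n.+1) #|` rat_fset r|%fset * abar_V iota V (n - r))%N.
Proof.
rewrite /abar_V rational_nmultisetsE; under eq_bigr do rewrite rational_nmultisetsE.
exact: (stable_mset_recurrence frob_pt_inj geom_point_frob geom_point_periodic in_rat_fset).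
Qed.

Lemma abar_V_parity n :
  (abar_V iota V n = \sum_(i < n.+1) a_V iota V i *
     (if 2 %| n - i then abar_V iota V ((n - i) %/ 2) else 0))%N.
Proof.
rewrite /abar_V rational_nmultisetsE /a_V.
under eq_bigr do rewrite rational_nmultisetsE rational_nsetsE.
exact: (stable_mset_parity frob_pt_inj geom_point_periodic in_rat_fset).
Qed.

Lemma abar_V0 : abar_V iota V 0 = 1%N.
Proof.
rewrite /abar_V (_ : rational_nmultisets _ _ = [set mset0]%classic) ?fset_set1 ?cardfs1 //.
apply/seteqP; split=> M /= => [[/eqP]|->]; first by rewrite size_mset_eq0 => /eqP.
rewrite rational_nmultisetsE; split; first exact: size_mset0.
by split=> p; rewrite ?in_mset0 ?mset0E.
Qed.

Lemma fbar_V_zeta : fbar_V iota V =1 zeta iota V.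
Proof.
apply: fps_expP => [//||n]; first by rewrite /fbar_V abar_V0.
rewrite /fbar_V -natrM abar_V_recurrence natr_sum big_nat_cond [RHS]big_nat_cond.
apply: eq_bigr => r /andP[/andP[r_gt0 _] _].
(* The factor [r] of the recurrence cancels the denominator in the exponent of [zeta]. *)
by rewrite natrM (gtn_eqF r_gt0) mulrCA mulfV ?mulr1 // pnatr_eq0 -lt0n.
Qed.

End Points.

Theorem theorem1p2 (k : finFieldType) (K : closedFieldType)
    (iota : {rmorphism k -> K}) (HK : is_algebraic_closure iota)
    (V : quasiproj k) :
  (f_V iota V =1 fps_div (zeta iota V) (fps_subXn 2 (zeta iota V))) /\
  (fbar_V iota V =1 zeta iota V).
Proof.
have fbarE := fbar_V_zeta HK V; split=> // n; apply/esym.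
(* The denominator has constant coefficient [1], so it can be cleared; what remains is the parity
   identity. *)
apply: (fps_divE (f := f_V iota V)) => [|m].
  by rewrite /fps_subXn dvdn0 div0n /zeta fps_exp0 oner_eq0.
rewrite -fbarE /fbar_V (abar_V_parity HK) natr_sum; apply: eq_bigr => i _.
by rewrite natrM /fps_subXn -fbarE; case: ifP.
Qed.
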